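(* Let $\varphi : [a,b] \to \mathbb{R}$ be a right continuous function of bounded variation with total variation $\upsilon(b) = V_a^b \varphi = 1$ and $\varphi(a) = 0$. Then there are sequences $(x_n)_{n\ge1}$ in $[a,b]$ and $(\varepsilon_n)_{n\ge1}$ in $\{\pm 1\}$ such that for every point of continuity $x \in [a,b]$ of $\varphi$ we have (a') $\lim_{N \to \infty} \frac{1}{N} \sum_{k=1}^N \chi_{[a,x)}(x_k) = \upsilon(x)$; (b') $\lim_{N \to \infty} \frac{1}{N} \sum_{k=1}^N \varepsilon_k \chi_{[a,x)}(x_k) = \varphi(x)$; (c') $\lim_{N \to \infty} \frac{1}{2N} \sum_{k=1}^N (1 + \varepsilon_k) \chi_{[a,x)}(x_k) = p(x)$; and (d') $\lim_{N \to \infty} \frac{1}{2N} \sum_{k=1}^N (1 - \varepsilon_k) \chi_{[a,x)}(x_k) = n(x)$.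
   Context: $[a,b]$ is a compact interval of the real line with $a<b$. $\chi_A$ is the characteristic function of $A$. For $\varphi:[a,b]\to\mathbb{R}$ of bounded variation, $V_a^x\varphi$ is the total variation of $\varphi$ on $[a,x]$, and $\upsilon, p, n$ are the functions of total, positive and negative variation of $\varphi$: $\upsilon(x) = V_a^x \varphi$, $p(x) = \frac12(\upsilon(x) + \varphi(x) - \varphi(a))$, $n(x) = \frac12(\upsilon(x) - \varphi(x) + \varphi(a))$ for $x \in [a,b]$. *)

(* Defs.v *)
From HB Require Import structures.
From mathcomp Require Import all_boot all_order all_algebra.
From mathcomp Require Import all_classical all_reals all_analysis.
Set Implicit Arguments.
Unset Strict Implicit.
Unset Printing Implicit Defensive.
Import Order.TTheory GRing.Theory Num.Theory.
Import numFieldNormedType.Exports.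
Local Open Scope classical_set_scope.
Local Open Scope ring_scope.

(* A function phi : [a, b] -> R is represented by a total phi : R -> R; every
   notion below depends only on the values of phi on [a, b]. *)

(* [total_variation] is \bar R-valued; it is finite when phi has bounded
   variation on [a, b] and x \in `[a, b]. *)
Definition upsilon (R : realType) (a : R) (phi : R -> R) (x : R) : R :=
  fine (total_variation a x phi).

(* The library's [pos_tv] and [neg_tv] omit the normalising term phi a. *)
Definition pos_variation (R : realType) (a : R) (phi : R -> R) (x : R) : R :=
  2^-1 * (upsilon a phi x + phi x - phi a).

Definition neg_variation (R : realType) (a : R) (phi : R -> R) (x : R) : R :=
  2^-1 * (upsilon a phi x - phi x + phi a).

(* At x = b right continuity is vacuous, phi being defined only on [a, b]. *)
Definition right_continuous_on (R : realType) (a b : R) (phi : R -> R) : Prop :=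
  forall x, x \in `[a, b[ -> phi y @[y --> x^'+] --> phi x.

(* Continuity relative to [a, b], hence one-sided at the end points. *)
Definition continuity_point (R : realType) (a b : R) (phi : R -> R) (x : R)
    : Prop :=
  x \in `[a, b] /\ phi y @[y --> within [set` `[a, b]] (nbhs x)] --> phi x.

(* Main.v *)
Require Import Defs.
From HB Require Import structures.
From mathcomp Require Import all_boot all_order all_algebra.
From mathcomp Require Import all_classical all_reals all_analysis.
From mathcomp Require Import zify ring lra.
Set Implicit Arguments.
Unset Strict Implicit.
Unset Printing Implicit Defensive.
Import Order.TTheory GRing.Theory Num.Theory.
Import numFieldNormedType.Exports.
Local Open Scope classical_set_scope.
Local Open Scope ring_scope.

(** The increasing functions p and n (positive and negative variation) vanish
    at a and satisfy p(b) + n(b) = v(b) = 1, with v = p + n and phi = p - n.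
    So p and n are distribution functions of two positive measures on [a, b] of
    total mass 1: together they form one probability measure on two copies of
    [a, b], labelled +1 and -1, and the sequence (x_k, eps_k) only has to be
    equidistributed for that measure.

    Such a sequence is the image of a sequence u_k equidistributed in [0, 1)
    under a generalised inverse of the distribution function.  Cut [0, 1) at
    p(b).  When u_k < p(b), put eps_k = 1 and take for x_k the p-quantile of
    u_k; otherwise put eps_k = -1 and take the n-quantile of u_k - p(b).  A
    quantile of u lies strictly left of x exactly when u < F(x), provided that
    F is left continuous at x ([quantile_lt]); at a continuity point of phi
    both p and n are, because the total variation is.  Hence the visits to
    [a, x) with eps_k = 1 are the k with u_k < p(x), those with eps_k = -1 are
    the k with p(b) <= u_k < p(b) + n(x), and their frequencies tend to p(x)
    and n(x).  The sum and the difference of these two limits are the limits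
    v(x) and phi(x).

    The equidistributed sequence is the van der Corput sequence in base 2, for
    which a recursion on the binary digits bounds the discrepancy
    ([vdc_discrepancy], [vdc_equidistributed]). *)

(** * The van der Corput sequence *)

(** The binary digits of [k] mirrored about the binary point.  The number [d] of
    digits read makes the recursion structural; any [d >= k] reads them all. *)
Fixpoint radical_inverse (R : realType) (d k : nat) : R :=
  if d is d'.+1 then ((odd k)%:R + radical_inverse R d' k./2) / 2 else 0.

Definition van_der_corput (R : realType) (k : nat) : R := radical_inverse R k k.

Lemma radical_inverse0 (R : realType) d : radical_inverse R d 0 = 0.
Proof. by elim: d => //= d ->; rewrite add0r mul0r. Qed.

Lemma radical_inverse_stable (R : realType) d k :
  (k <= d)%N -> radical_inverse R d k = van_der_corput R k.
Proof.
suff eq_depth d1 : forall d2 j, (j <= d1)%N -> (j <= d2)%N ->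
    radical_inverse R d1 j = radical_inverse R d2 j.
  by move=> kd; exact: eq_depth.
elim: d1 => [|d1 IH] d2 [|j] //; rewrite ?radical_inverse0 //.
case: d2 => // d2 j1 j2 /=; congr (_ / _); congr (_ + _).
by apply: IH; rewrite uphalf_half; lia.
Qed.

Lemma van_der_corputE (R : realType) k :
  van_der_corput R k = ((odd k)%:R + van_der_corput R k./2) / 2.
Proof.
rewrite -(@radical_inverse_stable R k.+1 k) //=; congr (_ / _); congr (_ + _).
by apply: radical_inverse_stable; lia.
Qed.

Lemma van_der_corput_double (R : realType) k :
  van_der_corput R k.*2 = van_der_corput R k / 2.
Proof. by rewrite van_der_corputE odd_double doubleK add0r. Qed.

Lemma van_der_corput_doubleS (R : realType) k :
  van_der_corput R k.*2.+1 = (1 + van_der_corput R k) / 2.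
Proof. by rewrite van_der_corputE /= odd_double uphalf_double. Qed.

Lemma van_der_corput_itv (R : realType) k : 0 <= van_der_corput R k < 1.
Proof.
suff: forall d j, 0 <= radical_inverse R d j < 1 by exact.
elim=> [|d IH] j /=; first by rewrite lexx ltr01.
by have /andP[] := IH j./2; case: (odd j) => /= ? ?; apply/andP; split; lra.
Qed.

Definition vdc_count (R : realType) (t : R) (N : nat) : R :=
  \sum_(0 <= k < N) (van_der_corput R k < t)%R%:R.

Lemma vdc_countS (R : realType) (t : R) N :
  vdc_count t N.+1 = vdc_count t N + (van_der_corput R N < t)%R%:R.
Proof. by rewrite /vdc_count big_nat_recr. Qed.

Lemma vdc_count_le0 (R : realType) (t : R) N : t <= 0 -> vdc_count t N = 0.
Proof.
move=> t0; apply: big1 => k _; rewrite ltNge.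
by have /andP[v0 _] := van_der_corput_itv R k; rewrite (le_trans t0 v0).
Qed.

Lemma vdc_count_ge1 (R : realType) (t : R) N : 1 <= t -> vdc_count t N = N%:R.
Proof.
move=> t1; rewrite /vdc_count (eq_bigr (fun=> 1)) => [|k _].
  by rewrite big_const_nat subn0 iter_addr_0.
by have /andP[_ v1] := van_der_corput_itv R k; rewrite (lt_le_trans v1 t1).
Qed.

(** The terms of even index are the sequence shrunk to [0, 1/2), those of odd
    index its translate in [1/2, 1): counting below [t] among twice as many
    terms amounts to counting below the two rescaled thresholds. *)
Lemma vdc_count_double (R : realType) (t : R) N :
  vdc_count t N.*2 = vdc_count (2 * t) N + vdc_count (2 * t - 1) N.
Proof.
elim: N => [|N IH]; first by rewrite /vdc_count !big_geq // addr0.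
rewrite doubleS !vdc_countS IH van_der_corput_double van_der_corput_doubleS.
have -> : (van_der_corput R N / 2 < t) = (van_der_corput R N < 2 * t).
  by apply/idP/idP => ?; lra.
have -> : ((1 + van_der_corput R N) / 2 < t) = (van_der_corput R N < 2 * t - 1).
  by apply/idP/idP => ?; lra.
by ring.
Qed.

(** One of the two thresholds of [vdc_count_double] lies outside (0, 1) and is
    counted without error, so doubling [N] leaves the error E unchanged.  An odd
    last term moves it by some d in [-1, 1], and
    (E + d)^2 <= 2 E^2 + 2 d^2 <= 4 M + 2 = 2 (2 M + 1) when E^2 <= 2 M.  The
    error is really logarithmic in [N]; the square root bound suffices for the
    frequencies and has this short induction. *)
Lemma vdc_discrepancy (R : realType) (t : R) N : 0 <= t <= 1 ->
  (vdc_count t N - N%:R * t) ^+ 2 <= 2 * N%:R.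
Proof.
elim/ltn_ind: N t => N IH t /andP[t0 t1].
have [->|N0] := eqVneq N 0%N.
  by rewrite /vdc_count big_geq // mul0r subrr expr0n mulr0.
set M := N./2; have MN : (M < N)%N by rewrite /M; lia.
have [s s01 Ms] : exists2 s : R, 0 <= s <= 1 &
    vdc_count t M.*2 - M.*2%:R * t = vdc_count s M - M%:R * s.
  have [th|th] := leP t 2^-1.
    exists (2 * t); first by apply/andP; split; lra.
    rewrite vdc_count_double (@vdc_count_le0 _ (2 * t - 1)); last by lra.
    by rewrite -mul2n natrM; ring.
  exists (2 * t - 1); first by apply/andP; split; lra.
  rewrite vdc_count_double (@vdc_count_ge1 _ (2 * t)); last by lra.
  by rewrite -mul2n natrM; ring.
have := IH M MN s s01; rewrite -Ms => {Ms s s01}.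
have NE : N = (odd N + M.*2)%N by rewrite odd_double_half.
have [oddN|evN] := boolP (odd N); last first.
  have -> : N = M.*2 by rewrite {1}NE (negbTE evN).
  move=> le2.
  by rewrite (le_trans le2) // ler_pM2l // ler_nat -addnn leq_addr.
have -> : N = M.*2.+1 by rewrite {1}NE oddN.
rewrite vdc_countS -(natr1 M.*2); set E := _ - M.*2%:R * t.
set c := (_ < _)%R%:R => le2.
have -> : vdc_count t M.*2 + c - (M.*2%:R + 1) * t = E + (c - t).
  by rewrite /E; ring.
have ct : -1 <= c - t <= 1.
  by rewrite /c; case: (_ < t) => /=; apply/andP; split; lra.
case/andP: ct => c1 c2.
have d1 : (c - t) ^+ 2 <= 1 by nra.
(* This square turns into (E + d)^2 <= 2 E^2 + 2 d^2 with d = c - t. *)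
have : 0 <= (E - (c - t)) ^+ 2 by exact: sqr_ge0.
by rewrite -mul2n natrM; nra.
Qed.

Lemma vdc_equidistributed (R : realType) (t : R) : 0 <= t <= 1 ->
  N%:R^-1 * vdc_count t N @[N --> \oo] --> t.
Proof.
move=> t01; apply/cvgrPdist_lt => e e0; near=> N.
have N2 : 2 / e ^+ 2 < N%:R by near: N; exact: nbhs_infty_gtr.
have N0 : 0 < N%:R :> R by apply: le_lt_trans N2; rewrite divr_ge0 ?sqr_ge0.
have e2 : 0 < e ^+ 2 by rewrite exprn_gt0.
rewrite distrC.
have -> : N%:R^-1 * vdc_count t N - t = (vdc_count t N - N%:R * t) / N%:R.
  by field; rewrite gt_eqF.
rewrite normrM normfV (gtr0_norm N0) ltr_pdivrMr //.
rewrite -(@ltr_pXn2r _ 2) ?nnegrE ?normr_ge0 ?mulr_ge0 ?(ltW e0) ?(ltW N0) //.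
rewrite real_normK ?num_real // (le_lt_trans (vdc_discrepancy _ t01)) //.
move: N2; rewrite ltr_pdivrMr // => N2.
by rewrite exprMn expr2 mulrA ltr_pM2r // mulrC.
Unshelve. all: by end_near. Qed.

(** * Quantiles *)

(** The strict inequality [u < F y] (the largest generalised inverse) makes
    [quantile_lt] an equality of events, with no exceptional value of [u]. *)
Definition quantile (R : realType) (a b : R) (F : R -> R) (u : R) : R :=
  inf [set y | y \in `[a, b] /\ u < F y].

Lemma quantile_has_inf (R : realType) (a b : R) (F : R -> R) (u : R) :
  a <= b -> u < F b -> has_inf [set y | y \in `[a, b] /\ u < F y].
Proof.
move=> ab uF; split; first by exists b; rewrite /= in_itv /= ab lexx.
by exists a => y [/itvP yab _]; rewrite yab.
Qed.

Lemma quantile_itv (R : realType) (a b : R) (F : R -> R) (u : R) :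
  a <= b -> u < F b -> quantile a b F u \in `[a, b].
Proof.
move=> ab uF; have [S0 Slb] := quantile_has_inf ab uF.
rewrite in_itv /=; apply/andP; split.
  by apply: lb_le_inf => // y [/itvP yab _]; rewrite yab.
by apply: ge_inf => //=; rewrite in_itv /= ab lexx.
Qed.

(** If [u < F x], left continuity already gives [u < F y] for some [y < x], so
    the infimum is below [x].  At [x = a] the bound [F a <= u] makes both sides
    false, hence no continuity is required there. *)
Lemma quantile_lt (R : realType) (a b x : R) (F : R -> R) (u : R) :
    {in `[a, b] &, {homo F : y z / y <= z}} -> x \in `[a, b] ->
    (a < x -> F y @[y --> x^'-] --> F x) -> F a <= u -> u < F b ->
  (quantile a b F u < x) = (u < F x).
Proof.
move=> Fnd xab Flc Fau uFb.
have /andP[ax xb] : a <= x <= b by rewrite in_itv in xab.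
have ab := le_trans ax xb.
apply/idP/idP => [qx|ux].
  have [y [yab uy] yx] := inf_lt (quantile_has_inf ab uFb).1 qx.
  by apply: lt_le_trans uy _; apply: Fnd => //; exact: ltW.
have {}ax : a < x.
  rewrite lt_neqAle ax andbT; apply: contraTneq ux => <-.
  by rewrite -leNgt.
suff [y [ay yx uy]] : exists y, [/\ a < y, y < x & u < F y].
  apply: le_lt_trans (yx); apply: ge_inf.
    by have [] := quantile_has_inf ab uFb.
  by rewrite /= in_itv /= (ltW ay) /= (le_trans (ltW yx)).
have : \forall y \near x^'-, [/\ a < y, y < x & u < F y].
  near=> y; split; near: y.
  - exact: nbhs_left_gt.
  - exact: nbhs_left_lt.
  - exact: (cvgr_gt _ (Flc ax)).
by move/filter_ex.
Unshelve. all: by end_near. Qed.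

(** * Positive and negative variations *)

Section jordan_components.
Context (R : realType) (a b : R) (phi : R -> R).
Context (bv : bounded_variation a b phi).

Lemma upsilonxx : upsilon a phi a = 0.
Proof. by rewrite /upsilon total_variationxx. Qed.

(** The monotonicity of both variations is the two halves of this bound. *)
Lemma upsilon_increment : {in `[a, b] &, forall x y, x <= y ->
  `|phi y - phi x| <= upsilon a phi y - upsilon a phi x}.
Proof.
move=> x y; rewrite !in_itv /= => /andP[ax xb] /andP[ay yb] xy.
have fx : total_variation a x phi \is a fin_num.
  by apply/bounded_variationP => //; exact: bounded_variationl bv.
have fxy : total_variation x y phi \is a fin_num.
  apply/bounded_variationP => //; apply: bounded_variationl yb _ => //.
  by apply: bounded_variationr bv => //; exact: le_trans yb.
rewrite /upsilon (total_variationD phi ax xy) fineD // addrAC subrr add0r.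
by rewrite -lee_fin fineK // total_variation_ge.
Qed.

Lemma pos_variation_nondecreasing :
  {in `[a, b] &, {homo pos_variation a phi : x y / x <= y}}.
Proof.
move=> x y xab yab xy; have := upsilon_increment xab yab xy.
by rewrite ler_norml /pos_variation => /andP[]; lra.
Qed.

Lemma neg_variation_nondecreasing :
  {in `[a, b] &, {homo neg_variation a phi : x y / x <= y}}.
Proof.
move=> x y xab yab xy; have := upsilon_increment xab yab xy.
by rewrite ler_norml /neg_variation => /andP[]; lra.
Qed.

(** Near the left of [x > a] every point belongs to [a, b], so continuity
    relative to [a, b] gives the left limit, even at [x = b]. *)
Lemma continuity_point_left x : continuity_point a b phi x -> a < x ->
  phi y @[y --> x^'-] --> phi x.
Proof.
move=> [+ ctn] ax; rewrite in_itv /= => /andP[_ xb].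
apply: cvg_trans ctn; apply: cvg_app.
move=> S; rewrite /within /= => Snbhs.
near=> y; have : `[a, b]%classic y -> S y.
  by near: y; apply: cvg_within; exact: Snbhs.
have ay : a < y by near: y; exact: nbhs_left_gt.
have yx : y < x by near: y; exact: nbhs_left_lt.
by apply; rewrite /= in_itv /= (ltW ay) (le_trans (ltW yx)).
Unshelve. all: by end_near. Qed.

Lemma pos_variation_left x : continuity_point a b phi x -> a < x ->
  pos_variation a phi y @[y --> x^'-] --> pos_variation a phi x.
Proof.
move=> ctn ax; have phil := continuity_point_left ctn ax.
have xb : x <= b by case: ctn => /andP[].
apply: cvgMr; apply: cvgB; last exact: cvg_cst.
by apply: cvgD => //; exact: total_variation_left_continuous bv.
Qed.

Lemma neg_variation_left x : continuity_point a b phi x -> a < x ->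
  neg_variation a phi y @[y --> x^'-] --> neg_variation a phi x.
Proof.
move=> ctn ax; have phil := continuity_point_left ctn ax.
have xb : x <= b by case: ctn => /andP[].
apply: cvgMr; apply: cvgD; last exact: cvg_cst.
by apply: cvgB => //; exact: total_variation_left_continuous bv.
Qed.

End jordan_components.

(** * Signed sampling of a function of bounded variation *)

Theorem theorem7 (R : realType) (a b : R) (hab : a < b) (phi : R -> R)
    (phi_rc : right_continuous_on a b phi)
    (phi_bv : bounded_variation a b phi)
    (phi_tv : upsilon a phi b = 1)
    (phi_a : phi a = 0) :
  exists (x_ : nat -> R) (eps : nat -> R),
    [/\ forall n : nat, (1 <= n)%N -> x_ n \in `[a, b],
        forall n : nat, (1 <= n)%N -> eps n = 1 \/ eps n = -1 &
        forall x : R, continuity_point a b phi x ->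
          [/\ (N%:R^-1 * \sum_(1 <= k < N.+1) \1_`[a, x[%classic (x_ k))
                @[N --> \oo] --> upsilon a phi x,
              (N%:R^-1 * \sum_(1 <= k < N.+1) eps k * \1_`[a, x[%classic (x_ k))
                @[N --> \oo] --> phi x,
              ((2 * N%:R)^-1 *
                 \sum_(1 <= k < N.+1) (1 + eps k) * \1_`[a, x[%classic (x_ k))
                @[N --> \oo] --> pos_variation a phi x &
              ((2 * N%:R)^-1 *
                 \sum_(1 <= k < N.+1) (1 - eps k) * \1_`[a, x[%classic (x_ k))
                @[N --> \oo] --> neg_variation a phi x]].
Proof.
set p := pos_variation a phi; set n := neg_variation a phi.
have pa : p a = 0 by rewrite /p /pos_variation upsilonxx phi_a; ring.
have na : n a = 0 by rewrite /n /neg_variation upsilonxx phi_a; ring.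
have pnb : p b + n b = 1.
  by rewrite /p /n /pos_variation /neg_variation phi_tv; field.
have pnD x : p x + n x = upsilon a phi x.
  by rewrite /p /n /pos_variation /neg_variation; field.
have pnB x : p x - n x = phi x.
  by rewrite /p /n /pos_variation /neg_variation phi_a; field.
have pnd : {in `[a, b] &, {homo p : x y / x <= y}}.
  exact: pos_variation_nondecreasing.
have nnd : {in `[a, b] &, {homo n : x y / x <= y}}.
  exact: neg_variation_nondecreasing.
have [aab bab] : a \in `[a, b] /\ b \in `[a, b].
  by rewrite !in_itv /= !lexx (ltW hab).
(* The sums start at index 1, the van der Corput sequence at index 0. *)
pose u k := van_der_corput R k.-1.
have u01 k : 0 <= u k < 1 by exact: van_der_corput_itv.
pose x_ k := if u k < p b then quantile a b p (u k)
             else quantile a b n (u k - p b).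
pose eps k : R := if u k < p b then 1 else -1.
have nub k : u k - p b < n b by have /andP[_] := u01 k; lra.
have x_ab k : x_ k \in `[a, b].
  by rewrite /x_; case: ifPn => ukb; apply: quantile_itv => //; exact: ltW.
exists x_, eps; split => [//|k _|x ctn].
  by rewrite /eps; case: ifP; [left|right].
have xab : x \in `[a, b] by case: ctn.
have [ax xb] : a <= x /\ x <= b by move: xab; rewrite in_itv /= => /andP[].
have p0 : 0 <= p x by rewrite -pa; exact: pnd.
have n0 : 0 <= n x by rewrite -na; exact: nnd.
have pb : p x <= p b by exact: pnd.
have nb : n x <= n b by exact: nnd.
have indE k : \1_`[a, x[%classic (x_ k) = (x_ k < x)%R%:R :> R.
  rewrite indicE mem_setE in_itv /=.
  by have := x_ab k; rewrite in_itv /= => /andP[->].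
have posE k : (1 + eps k) * \1_`[a, x[%classic (x_ k) = 2 * (u k < p x)%R%:R.
  rewrite indE /eps /x_; case: ifPn => [ukb|]; last first.
    rewrite -leNgt => pbu; rewrite subrr mul0r ltNge (le_trans pb pbu).
    by rewrite mulr0.
  rewrite quantile_lt //; first by move=> ?; exact: pos_variation_left ctn _.
  by rewrite pa; case/andP: (u01 k).
(* Writing the event p b <= u k < p b + n x as a difference of two events of the
   form u k < t reduces it to the counts of vdc_equidistributed. *)
have negE k : (1 - eps k) * \1_`[a, x[%classic (x_ k) =
    2 * ((u k < p b + n x)%R%:R - (u k < p b)%R%:R).
  rewrite indE /eps /x_; case: ifPn => [ukb|].
    by rewrite (lt_le_trans ukb) ?lerDl // !subrr mul0r mulr0.
  rewrite -leNgt => pbu; rewrite opprK subr0 quantile_lt //.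
  - by rewrite ltrBlDl.
  - by move=> ?; exact: neg_variation_left ctn _.
  - by rewrite na subr_ge0.
have countE t N : \sum_(1 <= k < N.+1) (u k < t)%R%:R = vdc_count t N.
  by rewrite big_add1.
have cvg_pos : ((2 * N%:R)^-1 *
    \sum_(1 <= k < N.+1) (1 + eps k) * \1_`[a, x[%classic (x_ k))
    @[N --> \oo] --> p x.
  under eq_fun => N.
    under eq_bigr => k _ do rewrite posE.
    rewrite -mulr_sumr countE invfM mulrACA mulVf // mul1r.
    over.
  by apply: vdc_equidistributed; apply/andP; split; lra.
have cvg_neg : ((2 * N%:R)^-1 *
    \sum_(1 <= k < N.+1) (1 - eps k) * \1_`[a, x[%classic (x_ k))
    @[N --> \oo] --> n x.
  under eq_fun => N.
    under eq_bigr => k _ do rewrite negE.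
    rewrite -mulr_sumr sumrB !countE invfM mulrACA mulVf // mul1r mulrBr.
    over.
  rewrite (_ : nbhs (n x) = nbhs (p b + n x - p b)); last by congr nbhs; ring.
  have pn01 : 0 <= p b + n x <= 1 by apply/andP; split; lra.
  have pb01 : 0 <= p b <= 1 by apply/andP; split; lra.
  exact: cvgB (vdc_equidistributed pn01) (vdc_equidistributed pb01).
split=> //.
- rewrite -pnD; apply: cvg_trans (cvgD cvg_pos cvg_neg).
  apply: near_eq_cvg; apply: nearW => N; rewrite fctE /=.
  rewrite -mulrDr -big_split /= mulr_sumr mulr_sumr.
  by apply: eq_bigr => k _; rewrite invfM; move: N%:R^-1 => c; field.
- rewrite -pnB; apply: cvg_trans (cvgB cvg_pos cvg_neg).
  apply: near_eq_cvg; apply: nearW => N; rewrite fctE /=.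
  rewrite -mulrBr -sumrB /= mulr_sumr mulr_sumr.
  by apply: eq_bigr => k _; rewrite invfM; move: N%:R^-1 => c; field.
Qed.
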